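(* For every integer $t\geq3$ there is a polynomial $p_t$ such that for every $\varepsilon>0$, every $n$-vertex $K_t$-free graph $G$ with minimum degree at least $\left(\frac{2t-5}{2t-3}+\varepsilon\right)n$ admits a graph homomorphism to some $K_t$-free graph $H$ with $|V(H)|\leq 2^{p_t(1/\varepsilon)}$.
   Context: A homomorphism $G\to H$ is a map $V(G)\to V(H)$ sending edges to edges. $K_t$ is the complete graph on $t$ vertices. *)

(* Defs.v *)
From HB Require Import structures.
From mathcomp Require Import all_boot all_order all_algebra.
From mathcomp Require Import reals exp.
Set Implicit Arguments. Unset Strict Implicit. Unset Printing Implicit Defensive.
Import Order.TTheory GRing.Theory Num.Theory.

Definition simple_graph (V : finType) (e : rel V) : Prop :=
  symmetric e /\ irreflexive e.

Definition is_clique (V : finType) (e : rel V) (S : {set V}) : Prop :=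
  forall x y, x \in S -> y \in S -> x != y -> e x y.

Definition Kt_free (V : finType) (e : rel V) (t : nat) : Prop :=
  ~ (exists S : {set V}, #|S| = t /\ is_clique e S).

Definition graph_hom (V W : finType) (e : rel V) (eW : rel W) (f : V -> W) : Prop :=
  forall x y, e x y -> eW (f x) (f y).

Definition deg (V : finType) (e : rel V) (v : V) : nat := #|[set u | e v u]|.

(* Main.v *)
Require Import Defs.
From HB Require Import structures.
From mathcomp Require Import all_boot all_order all_algebra.
From mathcomp Require Import boolp reals exp.
From mathcomp Require Import zify ring lra.
Import Order.TTheory GRing.Theory Num.Theory.

Set Implicit Arguments.
Unset Strict Implicit.
Unset Printing Implicit Defensive.

(* Write t = k + 2. Under the degree condition, among any t sets that each
   contain a vertex neighbourhood, two have an intersection spanning a positive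
   proportion of all k-tuples as k-cliques ([cliques_degree_contra]; for t = 3,
   three sets of density more than 1/3 cannot be pairwise almost disjoint).
   Let h_a(y) be the number of k-cliques in N(a) & N(y) and let F_a, a superset
   of N(a), consist of the y for which h_a(y) is small. If ab is an edge and a
   k-clique z lies in F_a & F_b, then the neighbourhoods of a, b and the
   vertices of z contradict the first fact; so F_a & F_b contains no k-clique.
   The function h_a is the image of a 0/1 vector under a fixed 0/1 matrix, whose
   bounded Hilbert-Schmidt norm lets 2^poly(1/eps) colours determine every h_a
   up to a small L2 error. In the quotient by colours, adjacent classes still
   have sets F whose intersection spans few k-cliques, so a loop or a K_t there
   would contradict the first fact once more. *)

(** * Counting ordered cliques inside a vertex set *)

Definition nbh (V : finType) (e : rel V) (x : V) : {set V} := [set u | e x u].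

(** For simple [e], each clique is counted once per ordering, so [#|V| ^ k] is the natural
    normalisation. *)
Definition cliques (V : finType) (e : rel V) (k : nat) (S : {set V}) : nat :=
  #|[set z : k.-tuple V | all (mem S) z && pairwise e z]|.

Lemma cliques0 (V : finType) (e : rel V) (S : {set V}) : cliques e 0 S = 1.
Proof.
rewrite /cliques (_ : [set _ | _] = [set: 0.-tuple V]).
  by rewrite cardsT card_tuple expn0.
by apply/setP => z; rewrite !inE tuple0.
Qed.

Lemma cliquesS (V : finType) (e : rel V) (k : nat) (S : {set V}) :
  cliques e k.+1 S = \sum_(w in S) cliques e k (S :&: nbh e w).
Proof.
rewrite /cliques -sum1_card.
rewrite (reindex (fun p : V * k.-tuple V => cons_tuple p.1 p.2)) /=; last first.
  exists (fun z => (thead z, behead_tuple z)) => [[x z] _|z _] /=.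
    by congr pair; apply/val_inj.
  by rewrite [RHS]tuple_eta; apply/val_inj.
rewrite (eq_bigl (fun p : V * k.-tuple V => (p.1 \in S) &&
    (p.2 \in [set z : k.-tuple V | all (mem (S :&: nbh e p.1)) z && pairwise e z]))).
  rewrite -(pair_big_dep (fun w => w \in S) (fun w z => z \in
    [set z : k.-tuple V | all (mem (S :&: nbh e w)) z && pairwise e z])
    (fun _ _ => 1)) /=.
  by apply: eq_bigr => w _; rewrite sum1_card.
move=> [w z]; rewrite !inE /= -andbA; congr (_ && _); rewrite !andbA -all_predI.
by congr (_ && _); apply: eq_all => u; rewrite !inE.
Qed.

Lemma leq_cliques (V : finType) (e : rel V) (k : nat) (S : {set V}) :
  cliques e k S <= #|V| ^ k.
Proof. by rewrite -card_tuple; apply: max_card. Qed.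

Lemma cliques_gt0P (V : finType) (e : rel V) (k : nat) (S : {set V}) :
  reflect (exists z : k.-tuple V, {subset z <= S} /\ pairwise e z)
          (0 < cliques e k S).
Proof.
apply: (iffP card_gt0P) => [[z]|[z [zS ez]]].
  by rewrite inE => /andP[/allP zS ez]; exists z.
by exists z; rewrite inE ez andbT; apply/allP.
Qed.

(** A tuple lost by deleting [E] has an entry in [E]: [k] positions, [#|E|] values, and the other
    [k.-1] entries free. At [k = 0] the factor [k] neutralises the truncated predecessor. *)
Lemma cliques_setD (V : finType) (e : rel V) (k : nat) (S E : {set V}) :
  cliques e k S <= cliques e k (S :\: E) + k * #|E| * #|V| ^ k.-1.
Proof.
elim: k S => [|k IHk] S; first by rewrite !cliques0.
rewrite !cliquesS (bigID (mem E)) /= addnC.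
have le1 : \sum_(w in S | w \in E) cliques e k (S :&: nbh e w) <= #|E| * #|V| ^ k.
  apply: (@leq_trans (\sum_(w in E) #|V| ^ k)); last by rewrite sum_nat_const.
  rewrite big_mkcondl /=; apply: leq_sum => w _.
  by case: ifP => // _; apply: leq_cliques.
have le2 : \sum_(w in S | w \notin E) cliques e k (S :&: nbh e w) <=
    \sum_(w in S :\: E) cliques e k ((S :\: E) :&: nbh e w) + k * #|E| * #|V| ^ k.
  apply: (@leq_trans (\sum_(w in S :\: E) (cliques e k ((S :\: E) :&: nbh e w)
      + k * #|E| * #|V| ^ k.-1))).
    rewrite (eq_bigl (fun w => w \in S :\: E)); last by move=> w; rewrite inE andbC.
    apply: leq_sum => w _; apply: leq_trans (IHk _) _; rewrite leq_add2r.
    by rewrite setDE setIAC -setDE.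
  rewrite big_split /= leq_add2l sum_nat_const.
  case: k {IHk le1} => [|k] //=; first by rewrite !mul0n muln0.
  by rewrite expnS [leqRHS]mulnCA leq_mul2r max_card orbT.
by apply: leq_trans (leq_add le2 le1) _; rewrite /= mulSn mulnDl; lia.
Qed.

(** * Clique counts in pairwise intersections of large sets *)

Lemma leq_sum_sub (I : finType) (P Q : pred I) (F G : I -> nat) :
  (forall i, P i -> Q i) -> (forall i, P i -> F i <= G i) ->
  \sum_(i | P i) F i <= \sum_(i | Q i) G i.
Proof.
move=> PQ FG; rewrite big_mkcond [leqRHS]big_mkcond; apply: leq_sum => i _.
by case: ifP => // Pi; rewrite PQ ?FG.
Qed.

Lemma subset_card_eq (T : finType) (A : {set T}) (m : nat) :
  m <= #|A| -> exists2 B : {set T}, B \subset A & #|B| = m.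
Proof.
move=> lemA; exists [set x in take m (enum A)].
  by apply/subsetP => x; rewrite inE => /mem_take; rewrite mem_enum.
rewrite cardsE (card_uniqP _); last by rewrite take_uniq ?enum_uniq.
by rewrite size_takel // -cardE.
Qed.

(* A vertex [w] lying in all but at most one of the sets [Nb i] extends every
   clique of [nbh e w] found in some [Nb i :&: Nb j]; passing to [U :&: nbh e w]
   lowers [#|U|] by at most [D], so the inequality between [D], [h] and [#|U|]
   is inherited with one set less. *)
Lemma cliques_sum_ge (V J : finType) (e : rel V) (D M h : nat)
    (Nb : J -> {set V}) (k : nat) (U : {set V}) (I : {set J}) :
  #|I| = k.+2 ->
  (forall x, x \in U -> #|U :\: nbh e x| <= D) ->
  (forall i, i \in I -> #|U :\: Nb i| <= D) ->
  M * (2 * k + 1) * D + 2 * h <= 2 * M * #|U| ->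
  h ^ k <= M ^ k *
    \sum_(i in I) \sum_(j in I | j != i) cliques e k (Nb i :&: Nb j :&: U).
Proof.
elim: k U I => [|k IHk] U I cardI degU NbU hU.
  rewrite !expn0 mul1n.
  have /cards2P[i [j [neq_ij ->]]] : #|I| == 2 by rewrite cardI.
  rewrite (bigD1 i) ?set21 //= (bigD1 j) ?set22 //=; last by rewrite eq_sym.
  by rewrite cliques0.
pose Iw w := [set i in I | w \in Nb i].
pose good := [set w in U | k.+2 <= #|Iw w|].
have good_ge : h <= M * #|good|.
  (* Double counting of pairs [(w, i)] with [w] outside [Nb i]: a bad vertex misses at least two of
     the [k.+3] sets, and each set misses at most [D] vertices of [U]. *)
  have bad_le : 2 * #|U :\: good| <= k.+3 * D.
    apply: (@leq_trans (\sum_(w in U) \sum_(i in I) (w \notin Nb i))).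
      rewrite (big_setID (U :\: good)) /=; apply: leq_trans (leq_addr _ _).
      rewrite (setIidPr (subsetDl _ _)) mulnC -sum_nat_const; apply: leq_sum => w.
      rewrite !inE => /andP[+ wU]; rewrite wU andTb -ltnNge => le_Iw.
      rewrite (eq_bigr (fun i => if w \notin Nb i then 1 else 0)); last first.
        by move=> i _; case: (w \notin _).
      rewrite -big_mkcondr sum1_card /=.
      have := cardsID [set i | w \in Nb i] I; rewrite cardI.
      rewrite (_ : I :&: _ = Iw w); last by apply/setP => i; rewrite !inE.
      rewrite (_ : #|I :\: _| = #|(fun i => (i \in I) && (w \notin Nb i))|); last first.
        by apply: eq_card => i; rewrite !inE andbC.
      by move=> cI; rewrite -(leq_add2l #|Iw w|) cI addn2.
    rewrite exchange_big /= -cardI -sum_nat_const; apply: leq_sum => i iI.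
    rewrite (eq_bigr (fun w => if w \notin Nb i then 1 else 0)); last first.
      by move=> w _; case: (w \notin _).
    rewrite -big_mkcondr sum1_card; apply: leq_trans (NbU i iI).
    by apply/eq_leq/eq_card => w; rewrite !inE andbC.
  have cardU : #|U| = #|good| + #|U :\: good|.
    rewrite -(cardsID good U) (setIidPr _) //.
    by apply/subsetP => w; rewrite inE => /andP[].
  rewrite cardU in hU.
  have : M * (2 * #|U :\: good|) <= M * (k.+3 * D) by rewrite leq_mul2l bad_le orbT.
  move: hU; nia.
have step w : w \in good -> h ^ k <= M ^ k * \sum_(i in Iw w)
    \sum_(j in Iw w | j != i) cliques e k ((Nb i :&: Nb j :&: U) :&: nbh e w).
  rewrite inE => /andP[wU /subset_card_eq[I' I'w cardI']].
  have sI' i : i \in I' -> i \in I.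
    by move=> /(subsetP I'w); rewrite inE => /andP[].
  have mon (A : {set V}) : #|(U :&: nbh e w) :\: A| <= #|U :\: A|.
    by apply: subset_leq_card; apply: setSD; apply: subsetIl.
  apply: leq_trans (IHk (U :&: nbh e w) I' cardI' _ _ _) _.
  - by move=> x; rewrite inE => /andP[xU _]; apply: leq_trans (mon _) (degU x xU).
  - by move=> i iI'; apply: leq_trans (mon _) (NbU i (sI' i iI')).
  (* Lowering [k] by one frees [2 * M * D] on the left, which pays for the at most [D] vertices of
     [U] outside [nbh e w]. *)
  - have := cardsID (nbh e w) U; have := degU w wU; move: hU; nia.
  rewrite leq_mul2l; apply/orP; right.
  apply: leq_sum_sub => [i /(subsetP I'w) //|i _].
  apply: leq_sum_sub => [j /andP[/(subsetP I'w) -> //]|j _].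
  by rewrite setIA.
apply: (@leq_trans (\sum_(w in good) M * (M ^ k * \sum_(i in Iw w)
    \sum_(j in Iw w | j != i) cliques e k (Nb i :&: Nb j :&: U :&: nbh e w)))).
  apply: (@leq_trans (\sum_(w in good) M * h ^ k)); last first.
    by apply: leq_sum => w /step hw; rewrite leq_mul2l hw orbT.
  by rewrite sum_nat_const expnS mulnA leq_mul2r (mulnC _ M) good_ge orbT.
rewrite -!big_distrr /= expnS -mulnA; do 2!(rewrite leq_mul2l; apply/orP; right).
under [leqRHS]eq_bigr => i _.
  under eq_bigr => j _ do rewrite cliquesS.
  rewrite (exchange_big_dep (mem U)) /=; last first.
    by move=> j w _; rewrite inE => /andP[].
  over.
rewrite (exchange_big_dep (mem U)) //=.
apply: leq_sum_sub => [w|w wg]; first by rewrite inE => /andP[].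
have wU : w \in U by move: wg; rewrite inE => /andP[].
apply: leq_sum_sub => [i|i]; rewrite inE => /andP[iI wi]; first by rewrite iI.
apply: leq_sum_sub => // j; rewrite inE => /andP[/andP[-> wj] ->] /=.
by rewrite !inE wi wj wU.
Qed.

(** * Hilbert-Schmidt norms and a finite colouring of vectors by their images *)

Local Open Scope ring_scope.

(** The squared Hilbert-Schmidt (Frobenius) norm; on a row vector, the squared Euclidean norm. *)
Definition sqnorm (R : pzSemiRingType) (m n : nat) (A : 'M[R]_(m, n)) : R :=
  \sum_i \sum_j A i j ^+ 2.

Lemma sqnorm_tr (R : pzSemiRingType) (m n : nat) (A : 'M[R]_(m, n)) :
  sqnorm A = \tr (A *m A^T).
Proof.
by apply: eq_bigr => i _; rewrite mxE; apply: eq_bigr => j _; rewrite mxE expr2.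
Qed.

Lemma sqnorm_ge0 (R : realDomainType) (m n : nat) (A : 'M[R]_(m, n)) :
  0 <= sqnorm A.
Proof. by do 2!apply: sumr_ge0 => ? _; apply: sqr_ge0. Qed.

Lemma sqnorm_col_mx (R : pzSemiRingType) (m1 m2 n : nat) (A : 'M[R]_(m1, n))
    (B : 'M[R]_(m2, n)) :
  sqnorm (col_mx A B) = sqnorm A + sqnorm B.
Proof.
rewrite /sqnorm big_split_ord /=; congr (_ + _); apply: eq_bigr => i _.
  by under eq_bigr do rewrite col_mxEu.
by under eq_bigr do rewrite col_mxEd.
Qed.

Lemma sqnormZ (R : comPzRingType) (m n : nat) (a : R) (A : 'M[R]_(m, n)) :
  sqnorm (a *: A) = a ^+ 2 * sqnorm A.
Proof.
rewrite /sqnorm mulr_sumr; apply: eq_bigr => i _; rewrite mulr_sumr.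
by apply: eq_bigr => j _; rewrite mxE exprMn.
Qed.

Lemma sqnormD_le (R : realDomainType) (m n : nat) (A B : 'M[R]_(m, n)) :
  sqnorm (A + B) <= 2 * (sqnorm A + sqnorm B).
Proof.
rewrite /sqnorm -big_split mulr_sumr; apply: ler_sum => i _ /=.
rewrite -big_split mulr_sumr; apply: ler_sum => j _ /=; rewrite mxE.
by have := sqr_ge0 (A i j - B i j); lra.
Qed.

Lemma sqnorm_eq0 (R : realDomainType) (m n : nat) (A : 'M[R]_(m, n)) :
  (sqnorm A == 0) = (A == 0).
Proof.
apply/idP/eqP => [|->]; last first.
  by rewrite /sqnorm big1 // => i _; rewrite big1 // => j _; rewrite mxE expr0n.
rewrite psumr_eq0 => [/allP A0|i _]; last by apply: sumr_ge0 => j _; apply: sqr_ge0.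
apply/matrixP => i j; rewrite mxE; apply/eqP; rewrite -sqrf_eq0.
have := A0 i (mem_index_enum i); rewrite psumr_eq0 => [/allP|? _]; last exact: sqr_ge0.
by apply; rewrite mem_index_enum.
Qed.

Lemma sqnorm0 (R : realDomainType) (m n : nat) : sqnorm (0 : 'M[R]_(m, n)) = 0.
Proof. by apply/eqP; rewrite sqnorm_eq0. Qed.

(** Pythagoras, column by column: [F^T *m F] is the orthogonal projection onto the row space of [F],
    and [F^T] preserves the norm of [F *m B]. *)
Lemma sqnorm_orthonormal (R : comPzRingType) (p k n : nat) (F : 'M[R]_(k, p))
    (B : 'M[R]_(p, n)) :
  F *m F^T = 1%:M ->
  sqnorm B = sqnorm (F *m B) + sqnorm (B - F^T *m (F *m B)).
Proof.
move=> F1; set C := F^T *m _.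
have nE q (A : 'M[R]_(q, n)) : sqnorm A = \tr (A^T *m A).
  by rewrite sqnorm_tr mxtrace_mulC.
have BC : B^T *m C = (F *m B)^T *m (F *m B).
  by rewrite /C trmx_mul !mulmxA.
have CB : C^T *m B = (F *m B)^T *m (F *m B).
  by rewrite /C trmx_mul trmxK !mulmxA.
have CC : C^T *m C = (F *m B)^T *m (F *m B).
  by rewrite /C trmx_mul trmxK -!mulmxA (mulmxA F) F1 mul1mx.
have -> : sqnorm (B - C) = \tr ((B^T - C^T) *m (B - C)) by rewrite nE [(B - C)^T]linearB.
rewrite !nE mulmxBl !mulmxBr BC CB CC subrr subr0 linearB /=.
by rewrite addrC subrK.
Qed.

Lemma bessel (R : realDomainType) (p k n : nat) (F : 'M[R]_(k, p))
    (B : 'M[R]_(p, n)) :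
  F *m F^T = 1%:M -> sqnorm (F *m B) <= sqnorm B.
Proof. by move=> F1; rewrite (sqnorm_orthonormal B F1) lerDl sqnorm_ge0. Qed.

Lemma sqnorm_trmx (R : pzSemiRingType) (m n : nat) (A : 'M[R]_(m, n)) :
  sqnorm A^T = sqnorm A.
Proof.
rewrite /sqnorm exchange_big; apply: eq_bigr => i _.
by apply: eq_bigr => j _; rewrite mxE.
Qed.

Lemma row_sqnorm (R : comPzRingType) (n : nat) (u : 'rV[R]_n) :
  u *m u^T = (sqnorm u)%:M.
Proof. by rewrite [LHS]mx11_scalar sqnorm_tr /mxtrace big_ord1. Qed.

Lemma normalize (R : rcfType) (n : nat) (u : 'rV[R]_n) :
  u != 0 -> exists2 v : 'rV[R]_n, v *m v^T = 1%:M & u = Num.sqrt (sqnorm u) *: v.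
Proof.
move=> u0; have su : 0 < sqnorm u by rewrite lt_def sqnorm_eq0 u0 sqnorm_ge0.
have s0 : Num.sqrt (sqnorm u) != 0 by rewrite gt_eqF // sqrtr_gt0.
exists ((Num.sqrt (sqnorm u))^-1 *: u); last by rewrite scalerA divff ?scale1r.
rewrite row_sqnorm sqnormZ exprVn sqr_sqrtr ?sqnorm_ge0 //.
by rewrite mulVf // gt_eqF.
Qed.

Lemma sqnormM_le (R : rcfType) (p n : nat) (u : 'rV[R]_p) (B : 'M[R]_(p, n)) :
  sqnorm (u *m B) <= sqnorm u * sqnorm B.
Proof.
have [->|/normalize[v v1 uv]] := eqVneq u 0.
  by rewrite mul0mx !sqnorm0 mul0r.
rewrite {1}uv -scalemxAl sqnormZ sqr_sqrtr ?sqnorm_ge0 //.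
by rewrite ler_wpM2l ?sqnorm_ge0 // bessel.
Qed.

(* Each row [f] of [F] with [sqnorm (f *m B) >= c] uses up [c] of [sqnorm B], so
   a greedy choice of orthonormal rows stops after [sqnorm B / c] steps. *)
Lemma dominant_rows (R : realType) (p n : nat) (B : 'M[R]_(p, n)) (c : R) :
  0 < c ->
  exists (k : nat) (F : 'M[R]_(k, p)),
    [/\ F *m F^T = 1%:M, c * k%:R <= sqnorm B &
        forall r : 'rV[R]_p, r *m F^T = 0 -> sqnorm (r *m B) <= c * sqnorm r].
Proof.
move=> c0; apply: contrapT => noF.
(* If every orthonormal family can be extended, there are families of any size [k] capturing at
   least [c * k] of [sqnorm B]; a size beyond [sqnorm B / c] contradicts Bessel. *)
have grow k : exists F : 'M[R]_(k, p),
    F *m F^T = 1%:M /\ c * k%:R <= sqnorm (F *m B).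
  elim: k => [|k [F [F1 ckF]]].
    exists 0; split; first by apply/matrixP => -[].
    by rewrite mulr0 sqnorm_ge0.
  have [r rF lt_r] : exists2 r : 'rV[R]_p, r *m F^T = 0 & c * sqnorm r < sqnorm (r *m B).
    apply: contrapT => nor; apply: noF; exists k, F; split=> //.
      exact: le_trans ckF (bessel _ F1).
    move=> r rF; rewrite leNgt; apply/negP => lt_r; apply: nor.
    by exists r.
  have r0 : r != 0.
    by apply: contraTneq lt_r => ->; rewrite mul0mx !sqnorm0 mulr0 ltxx.
  have [v v1 rv] := normalize r0.
  have s0 : Num.sqrt (sqnorm r) != 0.
    by rewrite gt_eqF // sqrtr_gt0 lt_def sqnorm_eq0 r0 sqnorm_ge0.
  have vF : v *m F^T = 0.
    by apply: (scalerI s0); rewrite scaler0 scalemxAl -rv.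
  have nv : sqnorm v = 1 by rewrite sqnorm_tr v1 mxtrace1.
  rewrite -(addn1 k); exists (col_mx F v); split.
    rewrite tr_col_mx mul_col_row F1 v1 vF -[F *m v^T]trmxK trmx_mul trmxK vF trmx0.
    by rewrite -scalar_mx_block.
  rewrite mul_col_mx sqnorm_col_mx natrD mulrDr lerD // mulr1.
  move: lt_r; rewrite rv -scalemxAl !sqnormZ.
  rewrite nv mulr1 mulrC ltr_pM2l ?exprn_even_gt0 //.
  exact: ltW.
have [F [F1]] := grow (Num.truncn (sqnorm B / c)).+1.
apply/negP; rewrite -ltNge; apply: le_lt_trans (bessel B F1) _.
by rewrite -ltr_pdivrMl // mulrC truncnS_gt.
Qed.

(* Vectors with the same colour have nearly the same coordinates along the rows
   of [dominant_rows], and the remaining components are almost killed by [B]. *)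
Lemma colouring_by_images (R : realType) (V : finType) (p n s : nat)
    (B : 'M[R]_(p, n)) (phi : V -> 'rV[R]_p) :
  (0 < p)%N -> (0 < n)%N -> (0 < s)%N ->
  (forall i j, 0 <= B i j <= 1) -> (forall v j, 0 <= phi v 0 j <= 1) ->
  exists (k : nat) (col : V -> {ffun 'I_k -> 'I_(2 * s ^ 2).+1}),
    (k <= s ^ 2)%N /\
    forall a b, col a = col b ->
      s%:R ^+ 2 * sqnorm ((phi a - phi b) *m B) <= 4 * n%:R * p%:R ^+ 2.
Proof.
move=> p0 n0 s0 B01 phi01.
have unit_sqnorm m q (A : 'M[R]_(m, q)) :
    (forall i j, -1 <= A i j <= 1) -> sqnorm A <= m%:R * q%:R.
  move=> A1; apply: (@le_trans _ _ (\sum_(i < m) \sum_(j < q) 1)).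
    apply: ler_sum => i _; apply: ler_sum => j _.
    by have /andP[A1l A1r] := A1 i j; nra.
  by rewrite !sumr_const !card_ord -mulrnA -natrM mulnC.
have pR : 0 < p%:R :> R by rewrite ltr0n.
have nR : 0 < n%:R :> R by rewrite ltr0n.
have sR : 0 < s%:R ^+ 2 :> R by rewrite exprn_gt0 ?ltr0n.
have B_le : sqnorm B <= p%:R * n%:R.
  by apply: unit_sqnorm => i j; have := B01 i j; lra.
have phi_le v : sqnorm (phi v) <= p%:R.
  rewrite -[p%:R]mul1r; apply: unit_sqnorm => i j.
  by rewrite ord1; have := phi01 v j; lra.
(* The threshold is the bound on [sqnorm B] divided by [s ^ 2], so at most [s ^ 2] rows are
   dominant. *)
have c0 : 0 < p%:R * n%:R / s%:R ^+ 2 :> R by rewrite divr_gt0 // mulr_gt0.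
have [k [F [F1 kB FB]]] := dominant_rows B c0.
have ks : k%:R <= s%:R ^+ 2 :> R.
  by rewrite -(ler_pM2l c0); apply: le_trans kB _; rewrite divfK ?gt_eqF.
pose crd v i := (phi v *m F^T) 0 i.
pose rp := Num.sqrt p%:R : R.
have rp0 : 0 < rp by rewrite sqrtr_gt0.
have rp2 : rp ^+ 2 = p%:R by rewrite sqr_sqrtr ?ltW.
have crd_le v i : `|crd v i| <= rp.
  rewrite -sqrtr_sqr; apply: ler_wsqrtr.
  apply: le_trans (phi_le v); rewrite -[sqnorm (phi v)]sqnorm_trmx.
  apply: le_trans (bessel (phi v)^T F1); rewrite -[F *m _]trmxK sqnorm_trmx.
  rewrite trmx_mul trmxK /sqnorm big_ord1 (bigD1 i) //= lerDl.
  by apply: sumr_ge0 => j _; apply: sqr_ge0.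
(* Coordinates lie in [[-rp, rp]]; [g] rescales them to [[0, 2 * s ^ 2]], so equal integer parts put
   coordinates within [rp / s ^ 2] of each other. *)
pose g v i : R := (crd v i / rp + 1) * s%:R ^+ 2.
have g_bnd v i : 0 <= g v i <= (2 * s ^ 2)%:R.
  have : -1 <= crd v i / rp <= 1.
    by rewrite -ler_norml normrM normfV (gtr0_norm rp0) ler_pdivrMr ?mul1r.
  rewrite /g natrM natrX; move: sR; set S := _ ^+ 2; nra.
exists k, (fun v => [ffun i => inord (Num.truncn (g v i))]); split.
  by rewrite -(ler_nat R) natrX.
move=> a b /ffunP col_ab.
have crd_ab i : (crd a i - crd b i) ^+ 2 <= p%:R / (s%:R ^+ 2) ^+ 2.
  have := col_ab i; rewrite !ffunE => /(congr1 val) /=.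
  have g_lt v : (Num.truncn (g v i) < (2 * s ^ 2).+1)%N.
    rewrite ltnS -(ler_nat R); case/andP: (g_bnd v i) => g0.
    by apply: le_trans; rewrite truncn_le.
  rewrite !inordK // => eq_tr.
  have tr v : (Num.truncn (g v i))%:R <= g v i < (Num.truncn (g v i)).+1%:R.
    by apply: truncn_itv; case/andP: (g_bnd v i).
  have : (g a i - g b i) ^+ 2 <= 1.
    have := tr a; have := tr b; rewrite eq_tr -natr1; set T := _%:R.
    move=> /andP[T1 T2] /andP[T3 T4].
    have [] : -1 <= g a i - g b i /\ g a i - g b i <= 1 by split; lra.
    by set y := g a i - g b i; nra.
  have -> : g a i - g b i = (crd a i - crd b i) / rp * s%:R ^+ 2.
    by rewrite /g; ring.
  rewrite exprMn expr_div_n rp2 ler_pdivlMr ?exprn_gt0 ?ltr0n //.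
  by rewrite mulrAC ler_pdivrMr // mul1r.
set d := phi a - phi b.
have d_le : sqnorm d <= p%:R.
  rewrite -[p%:R]mul1r; apply: unit_sqnorm => i j.
  by rewrite ord1 !mxE; have := phi01 a j; have := phi01 b j; lra.
(* The orthogonal projection of [d] onto the row space of [F]: it is short because the colours
   agree, while [B] shrinks the remainder [d - d1]. *)
pose d1 := d *m F^T *m F.
have dF_le : sqnorm (d *m F^T) <= p%:R / s%:R ^+ 2.
  rewrite /sqnorm big_ord1.
  apply: (@le_trans _ _ (\sum_(i < k) p%:R / (s%:R ^+ 2) ^+ 2)).
    apply: ler_sum => i _; apply: le_trans (crd_ab i).
    have -> // : (d *m F^T) 0 i = crd a i - crd b i.
    by rewrite /d mulmxBl /crd; move: (phi a *m _) (phi b *m _) => x y; rewrite !mxE.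
  rewrite sumr_const card_ord -[_ *+ k]mulr_natr.
  rewrite -mulrA ler_pM2l // -ler_pdivlMl ?invr_gt0 ?exprn_gt0 ?ltr0n //.
  by rewrite invrK expr2 mulrK // unitfE gt_eqF.
have d1_le : sqnorm d1 <= p%:R / s%:R ^+ 2.
  by apply: le_trans dF_le; rewrite /d1 !sqnorm_tr trmx_mul mulmxA -(mulmxA _ F) F1 mulmx1.
have r_le : sqnorm (d - d1) <= p%:R.
  apply: le_trans d_le; rewrite -[leRHS]sqnorm_trmx (sqnorm_orthonormal _ F1).
  rewrite -[sqnorm (d - d1)]sqnorm_trmx linearB /= /d1 !trmx_mul trmxK.
  by rewrite lerDr sqnorm_ge0.
have rF : (d - d1) *m F^T = 0.
  by rewrite mulmxBl /d1 -(mulmxA _ F) F1 mulmx1 subrr.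
have e1 : sqnorm (d1 *m B) <= p%:R ^+ 2 * n%:R / s%:R ^+ 2.
  apply: le_trans (sqnormM_le _ _) _.
  have -> : p%:R ^+ 2 * n%:R / s%:R ^+ 2 = p%:R / s%:R ^+ 2 * (p%:R * n%:R) :> R.
    by rewrite expr2; ring.
  by apply: ler_pM; rewrite ?sqnorm_ge0.
have e2 : sqnorm ((d - d1) *m B) <= p%:R ^+ 2 * n%:R / s%:R ^+ 2.
  apply: le_trans (FB _ rF) _.
  have -> : p%:R ^+ 2 * n%:R / s%:R ^+ 2 = p%:R * n%:R / s%:R ^+ 2 * p%:R :> R.
    by rewrite expr2; ring.
  by rewrite ler_pM2l.
rewrite mulrC -ler_pdivlMr //.
have -> : d *m B = d1 *m B + (d - d1) *m B by rewrite -mulmxDl addrC subrK.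
apply: le_trans (sqnormD_le _ _) _.
have -> : 4 * n%:R * p%:R ^+ 2 / s%:R ^+ 2 =
    2 * (p%:R ^+ 2 * n%:R / s%:R ^+ 2 + p%:R ^+ 2 * n%:R / s%:R ^+ 2) :> R.
  by ring.
by rewrite ler_pM2l // lerD.
Qed.

Local Close Scope ring_scope.

(** * The degree condition and the codegree colouring *)

(** [cliques_sum_ge] with [U] the whole vertex set, [M = 2 * s] and [h = #|V|] bounds the sum over
    ordered pairs from below, so some pair among at most [k.+2 ^ 2] has a rich intersection. Here
    [s] plays the role of [1 / eps]. *)
Lemma cliques_degree_contra (V : finType) (e : rel V) (k s : nat)
    (Nb : 'I_k.+2 -> {set V}) :
  0 < #|V| -> 0 < s ->
  (forall v, s * (2 * k + 1) * (#|V| - #|nbh e v|) + (2 * k + 1) * #|V| <= 2 * #|V| * s) ->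
  (forall i, exists v, nbh e v \subset Nb i) ->
  (forall i j, i != j -> cliques e k (Nb i :&: Nb j) * (k.+2 ^ 2 * (2 * s) ^ k) < #|V| ^ k) ->
  False.
Proof.
move=> V0 s0 degV NbV few.
pose D := \max_v (#|V| - #|nbh e v|).
have cardTD (A : {set V}) : #|[set: V] :\: A| = #|V| - #|A|.
  by rewrite setTD cardsCs setCK.
have degD v : #|V| - #|nbh e v| <= D by apply: (@bigop.leq_bigmax _ (fun v => #|V| - #|nbh e v|)).
have hD : 2 * s * (2 * k + 1) * D + 2 * #|V| <= 2 * (2 * s) * #|[set: V]|.
  have [v ->] : exists v, D = #|V| - #|nbh e v|.
    by case: (@bigop.eq_bigmax V (fun v => #|V| - #|nbh e v|) V0) => v; exists v.
  by rewrite cardsT; have := degV v; nia.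
have cardI : #|[set: 'I_k.+2]| = k.+2 by rewrite cardsT card_ord.
have := cliques_sum_ge cardI _ _ hD (e := e) (Nb := Nb).
rewrite leqNgt => /(_ _ _)/negP; apply.
- by move=> v _; rewrite cardTD.
- move=> i _; have [v vi] := NbV i; apply: leq_trans (degD v).
  by rewrite cardTD leq_sub2l // subset_leq_card.
have few' i j : i != j ->
    k.+2 ^ 2 * ((2 * s) ^ k * cliques e k (Nb i :&: Nb j :&: [set: V])) <= #|V| ^ k - 1.
  by move=> /few; rewrite setIT; lia.
rewrite -(@ltn_pmul2l (k.+2 ^ 2)) //.
rewrite !big_distrr /=.
apply: (@leq_ltn_trans (\sum_(i in [set: 'I_k.+2]) \sum_(j in [set: 'I_k.+2])
   (#|V| ^ k - 1))).
  apply: leq_sum => i _; rewrite !big_distrr /=.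
  rewrite big_mkcondr; apply: leq_sum => j _.
  by case: ifP => // ji; rewrite few' // eq_sym.
rewrite !sum_nat_const cardI mulnA mulnn ltn_pmul2l //.
by rewrite subn1 prednK // expn_gt0 V0.
Qed.

(** The codegree function of [a] is [phi a *m B]: [phi a] marks the tuples inside [nbh e a], and [B]
    records which tuples are cliques inside each neighbourhood. *)
Lemma codegree_colouring (R : realType) (V : finType) (e : rel V) (k s : nat) :
  0 < #|V| -> 0 < s ->
  exists (m : nat) (col : V -> {ffun 'I_m -> 'I_(2 * s ^ 2).+1}),
    m <= s ^ 2 /\
    forall a b, col a = col b ->
      (s%:R ^+ 2 * (\sum_y ((cliques e k (nbh e a :&: nbh e y))%:R -
                            (cliques e k (nbh e b :&: nbh e y))%:R) ^+ 2)
       <= 4 * #|V|%:R * (#|V| ^ k)%:R ^+ 2 :> R)%R.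
Proof.
move=> V0 s0; pose T := {: k.-tuple V}.
have cardT : #|T| = #|V| ^ k by rewrite card_tuple.
pose B := (\matrix_(i < #|T|, j < #|V|)
  (all (mem (nbh e (enum_val j))) (enum_val i : k.-tuple V)
   && pairwise e (enum_val i : k.-tuple V))%:R : 'M[R]_(_, _))%R.
pose phi a := (\row_(i < #|T|)
  (all (mem (nbh e a)) (enum_val i : k.-tuple V))%:R : 'rV[R]__)%R.
have bool01 (b : bool) : (0 <= (b%:R : R) <= 1)%R by case: b; rewrite ?lexx ler01.
have phiB a j : ((phi a *m B) 0 j = (cliques e k (nbh e a :&: nbh e (enum_val j)))%:R)%R.
  rewrite mxE /cliques -sum1_card natr_sum [RHS]big_mkcond /=.
  rewrite [RHS](reindex (@enum_val T predT)) /=; last first.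
    by exists enum_rank => x _; rewrite ?enum_valK ?enum_rankK.
  apply: eq_bigr => i _; rewrite !mxE -natrM mulnb inE andbA -all_predI.
  rewrite (@eq_all _ _ (mem (nbh e a :&: nbh e (enum_val j)))); last first.
    by move=> u; rewrite !inE.
  by case: (_ && _).
have [|||||m [col [ms colP]]] := @colouring_by_images R V #|T| #|V| s B phi.
- by rewrite cardT expn_gt0 V0.
- by [].
- by [].
- by move=> i j; rewrite mxE.
- by move=> a j; rewrite mxE.
exists m, col; split=> // a b /colP le_s.
rewrite -cardT; apply: le_trans le_s.
rewrite le_eqVlt; apply/orP; left; apply/eqP; congr (_ * _)%R.
rewrite /sqnorm big_ord1 (reindex (@enum_val V predT)) /=; last first.
  by exists enum_rank => x _; rewrite ?enum_valK ?enum_rankK.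
apply: eq_bigr => j _; rewrite mulmxBl -!phiB.
by move: (phi a *m B)%R (phi b *m B)%R => x y; rewrite !mxE.
Qed.

(** Subtraction on naturals truncates, so the two tests together say that the codegrees at [y]
    differ by at least [#|V| ^ k / (2 * L)]. *)
Definition far (V : finType) (e : rel V) (k L : nat) (a b : V) : {set V} :=
  [set y | (#|V| ^ k <= 2 * L * (cliques e k (nbh e a :&: nbh e y)
                                - cliques e k (nbh e b :&: nbh e y)))
        || (#|V| ^ k <= 2 * L * (cliques e k (nbh e b :&: nbh e y)
                                - cliques e k (nbh e a :&: nbh e y)))].

(** Chebyshev's inequality: each vertex of [far] contributes at least [(#|V| ^ k / (2 * L)) ^ 2] to
    the sum of squares. *)
Lemma card_far (R : realType) (V : finType) (e : rel V) (k L s : nat) (a b : V) :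
  0 < #|V| ->
  (s%:R ^+ 2 * (\sum_y ((cliques e k (nbh e a :&: nbh e y))%:R -
                        (cliques e k (nbh e b :&: nbh e y))%:R) ^+ 2)
     <= 4 * #|V|%:R * (#|V| ^ k)%:R ^+ 2 :> R)%R ->
  s ^ 2 * #|far e k L a b| <= 16 * L ^ 2 * #|V|.
Proof.
move=> V0; set N := #|V| ^ k; set h := fun a y => cliques e k (nbh e a :&: nbh e y).
have N0 : (0 < N%:R :> R)%R by rewrite ltr0n expn_gt0 V0.
have le_far : ((#|far e k L a b|)%:R * N%:R ^+ 2 <=
    (2 * L)%:R ^+ 2 * \sum_y ((h a y)%:R - (h b y)%:R) ^+ 2 :> R)%R.
  rewrite mulr_sumr mulr_natl -sumr_const big_mkcond /=; apply: ler_sum => y _.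
  case: ifP => [|_]; last by rewrite mulr_ge0 ?sqr_ge0.
  have sub_le (x z : nat) : N <= 2 * L * (x - z) ->
      (N%:R ^+ 2 <= (2 * L)%:R ^+ 2 * (x%:R - z%:R) ^+ 2 :> R)%R.
    have [/eqP -> |zx] := leqP x z.
      by rewrite muln0 leqNgt -(ltr0n R) N0.
    rewrite -(ler_nat R) natrM natrB ?(ltnW zx) // -exprMn => le_N.
    by rewrite !expr2; apply: ler_pM => //; apply: ltW.
  rewrite inE => /orP[] /sub_le //.
  by rewrite -[(((cliques e k (nbh e b :&: _))%:R - _) ^+ 2)%R]sqrrN opprB.
move=> le_s; rewrite -(ler_nat R) -(ler_pM2r (exprn_gt0 2 N0)).
rewrite !natrM !natrX in le_far *.
have s20 : (0 <= s%:R ^+ 2 :> R)%R by rewrite sqr_ge0.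
have L20 : (0 <= (2 * L%:R) ^+ 2 :> R)%R by rewrite sqr_ge0.
rewrite -mulrA; apply: le_trans (ler_wpM2l s20 le_far) _.
rewrite mulrCA; apply: le_trans (ler_wpM2l L20 le_s) _.
by rewrite le_eqVlt; apply/orP; left; apply/eqP; rewrite /N natrX; ring.
Qed.

(** * Loose neighbourhoods in a clique-free graph *)

Lemma Kt_free_pairwise (V : finType) (e : rel V) (t : nat) (z : seq V) :
  simple_graph e -> Kt_free e t -> size z = t -> ~~ pairwise e z.
Proof.
move=> [e_sym e_irr] Kfree sz; apply/negP => ez; apply: Kfree.
exists [set x in z]; split.
  by rewrite cardsE (card_uniqP (pairwise_uniq e_irr ez)).
move=> x y; rewrite !inE => /(nthP x)[i iz <-] /(nthP x)[j jz <-] ne.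
have ltij := pairwiseP x ez i j iz jz.
have ltji := pairwiseP x ez j i jz iz.
case: (ltngtP i j) => [/ltij //|/ltji|eq_ij]; first by rewrite e_sym.
by rewrite eq_ij eqxx in ne.
Qed.

Lemma cliques_edge (V : finType) (e : rel V) (k : nat) (a b : V) :
  simple_graph e -> Kt_free e k.+2 -> e a b ->
  cliques e k (nbh e a :&: nbh e b) = 0.
Proof.
move=> eS Kfree eab; apply/eqP; rewrite -leqn0 leqNgt.
apply/negP => /cliques_gt0P[z [zab ez]].
have za : all (e a) z by apply/allP => u /zab; rewrite !inE => /andP[].
have zb : all (e b) z by apply/allP => u /zab; rewrite !inE => /andP[].
have := @Kt_free_pairwise _ _ _ [:: a, b & z] eS Kfree.
by rewrite /= size_tuple eab za zb ez => /(_ erefl).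
Qed.

(* A superset of [nbh e a] that, unlike [nbh e a] itself, hardly changes when [a]
   is replaced by a vertex of the same colour. *)
Definition loose_nbh (V : finType) (e : rel V) (k L : nat) (a : V) : {set V} :=
  [set y | 2 * L * cliques e k (nbh e a :&: nbh e y) < #|V| ^ k].

Lemma nbh_loose (V : finType) (e : rel V) (k L : nat) (a : V) :
  0 < #|V| -> simple_graph e -> Kt_free e k.+2 ->
  nbh e a \subset loose_nbh e k L a.
Proof.
move=> V0 eS Kfree; apply/subsetP => y; rewrite !inE => eay.
by rewrite cliques_edge // muln0 expn_gt0 V0.
Qed.

(** Outside the exceptional sets [far], the intersection holds no [k]-clique [z], since [a], [b] and
    [z] would give [k.+2] neighbourhoods with sparse pairwise intersections. Restoring the few
    exceptional vertices adds few cliques. *)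
Lemma cliques_loose (V : finType) (e : rel V) (k s q : nat) (a b a0 b0 : V) :
  let L := k.+2 ^ 2 * (2 * s) ^ k in
  0 < s -> 0 < #|V| -> 64 * k * L ^ 3 <= q ->
  simple_graph e -> Kt_free e k.+2 ->
  (forall v, s * (2 * k + 1) * (#|V| - #|nbh e v|) + (2 * k + 1) * #|V|
             <= 2 * #|V| * s) ->
  e a b -> q * #|far e k L a a0| <= 16 * L ^ 2 * #|V| ->
  q * #|far e k L b b0| <= 16 * L ^ 2 * #|V| ->
  cliques e k (loose_nbh e k L a0 :&: loose_nbh e k L b0) * L < #|V| ^ k.
Proof.
move=> L s0 V0 qL eS Kfree degV eab far_a far_b.
have [e_sym e_irr] := eS.
have L0 : 0 < L by rewrite muln_gt0 !expn_gt0 muln_gt0 s0.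
have N0 : 0 < #|V| ^ k by rewrite expn_gt0 V0.
set S := _ :&: _; pose E := far e k L a a0 :|: far e k L b b0.
(* Looseness at [c0] and closeness of [c] to [c0] each cost less than, respectively,
   [#|V| ^ k / (2 * L)]; together they stay below [#|V| ^ k / L]. *)
have near c c0 y : y \in loose_nbh e k L c0 -> y \notin far e k L c c0 ->
    cliques e k (nbh e c :&: nbh e y) * L < #|V| ^ k.
  rewrite !inE negb_or -!ltnNge => y1 /andP[y2 _].
  move: y1 y2; rewrite mulnBr; lia.
have S0 : cliques e k (S :\: E) = 0.
  apply/eqP; rewrite -leqn0 leqNgt; apply/negP => /cliques_gt0P[z [zS ez]].
  pose r u v := cliques e k (nbh e u :&: nbh e v) * L < #|V| ^ k.
  have sub_r : subrel e r by move=> u v euv; rewrite /r cliques_edge.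
  have rw : pairwise r [:: a, b & z].
    rewrite /= sub_r //=; apply/and3P; split.
    - apply/allP => y /zS; rewrite !inE negb_or => /andP[/andP[ya _] /andP[ya0 _]].
      by apply: (near a a0); rewrite inE.
    - apply/allP => y /zS; rewrite !inE negb_or => /andP[/andP[_ yb] /andP[_ yb0]].
      by apply: (near b b0); rewrite inE.
    - exact: sub_pairwise ez.
  apply: (@cliques_degree_contra V e k s (fun i => nbh e (nth a [:: a, b & z] i))) => //.
    by move=> i; exists (nth a [:: a, b & z] i).
  have sz : size [:: a, b & z] = k.+2 by rewrite /= size_tuple.
  have lt_r (i j : 'I_k.+2) : i < j -> r (nth a [:: a, b & z] i) (nth a [:: a, b & z] j).
    by apply: (pairwiseP a rw); rewrite inE sz.
  move=> i j; case: (ltngtP i j) => [/lt_r //|/lt_r|/val_inj ->]; last by rewrite eqxx.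
  by rewrite setIC.
have cardE : #|E| <= #|far e k L a a0| + #|far e k L b b0| by rewrite cardsU leq_subr.
(* Here [#|E| <= 32 * L ^ 2 * #|V| / q]; the constant 64 in [q] leaves a spare factor 2, which makes
   the bound strict. *)
have kE : k * #|E| * L < #|V|.
  have [->|k0] := posnP k; first by [].
  have le32 : 64 * k * L ^ 3 * #|E| <= 32 * L ^ 2 * #|V|.
    apply: leq_trans (leq_mul qL cardE) _; rewrite mulnDr.
    by apply: leq_trans (leq_add far_a far_b) _; lia.
  have L2 : 0 < 32 * L ^ 2 by rewrite muln_gt0 expn_gt0 L0.
  have : 32 * L ^ 2 * (2 * (k * #|E| * L)) <= 32 * L ^ 2 * #|V|.
    by apply: leq_trans le32; rewrite expnS; lia.
  by rewrite leq_pmul2l //; lia.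
have := cliques_setD e k S E; rewrite S0 add0n => le_S.
apply: leq_ltn_trans (leq_mul le_S (leqnn L)) _.
have [k0|k0] := posnP k; first by rewrite k0 !mul0n.
rewrite mulnAC -{3}(prednK k0) expnS ltn_pmul2r //.
by rewrite expn_gt0 V0.
Qed.

(** * The quotient by colours *)

Definition quotient_rel (V W : finType) (e : rel V) (f : V -> W) : rel W :=
  [rel c d | [exists a, exists b, [&& e a b, f a == c & f b == d]]].

Lemma homomorphic_quotient (R : realType) (V : finType) (e : rel V) (k s : nat) :
  let q := 64 * k * (k.+2 ^ 2 * (2 * s) ^ k) ^ 3 in
  0 < k -> 0 < s -> 0 < #|V| ->
  simple_graph e -> Kt_free e k.+2 ->
  (forall v, s * (2 * k + 1) * (#|V| - #|nbh e v|) + (2 * k + 1) * #|V|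
             <= 2 * #|V| * s) ->
  exists (m : nat) (col : V -> {ffun 'I_m -> 'I_(2 * q ^ 2).+1}),
    [/\ m <= q ^ 2, simple_graph (quotient_rel e col)
      & Kt_free (quotient_rel e col) k.+2].
Proof.
set L := k.+2 ^ 2 * (2 * s) ^ k => q k0 s0 V0 eS Kfree degV.
have [e_sym e_irr] := eS.
have L0 : 0 < L by rewrite muln_gt0 !expn_gt0 muln_gt0 s0.
have q0 : 0 < q by rewrite /q muln_gt0 expn_gt0 L0 muln_gt0 k0.
(* Colouring at precision [q] gives [card_far] the factor [q ^ 2 >= q], as [cliques_loose]
   demands. *)
have [m [col [mq colP]]] := codegree_colouring R e k V0 q0.
exists m, col.
have few a b a0 b0 : e a b -> col a = col a0 -> col b = col b0 ->
    cliques e k (loose_nbh e k L a0 :&: loose_nbh e k L b0) * L < #|V| ^ k.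
  move=> eab aa0 bb0; apply: (@cliques_loose V e k s (q ^ 2) a b) => //.
  - by rewrite -/L -/q; apply: leq_pmull.
  - exact: card_far (colP _ _ aa0).
  - exact: card_far (colP _ _ bb0).
(* One argument for both obstructions: a constant [c] excludes loops, and class representatives
   exclude cliques. *)
have contra (c : 'I_k.+2 -> V) : (forall i j, i != j ->
    quotient_rel e col (col (c i)) (col (c j))) -> False.
  move=> ec; apply: (@cliques_degree_contra V e k s (fun i => loose_nbh e k L (c i))) => //.
    by move=> i; exists (c i); apply: nbh_loose.
  move=> i j /ec /existsP[a /existsP[b /and3P[eab /eqP ai /eqP bj]]].
  exact: few eab ai bj.
split=> //; first split.
- have sub c d : quotient_rel e col c d -> quotient_rel e col d c.
    move=> /existsP[a /existsP[b /and3P[eab ac bd]]].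
    by apply/existsP; exists b; apply/existsP; exists a; rewrite e_sym eab ac bd.
  by move=> c d; apply/idP/idP; apply: sub.
- move=> c; apply: negbTE; apply/negP => /existsP[a /existsP[b /and3P[eab /eqP ac /eqP bc]]].
  apply: (contra (fun=> a)) => _ _ _; rewrite ac.
  by apply/existsP; exists a; apply/existsP; exists b; rewrite eab ac bc eqxx.
move=> [S [cardS Sclique]].
have [v0 _] : exists v0 : V, v0 \in V by apply/card_gt0P.
pose c (i : 'I_k.+2) := enum_val (cast_ord (esym cardS) i).
have c_inj : injective c.
  by move=> i j /enum_val_inj /cast_ord_inj.
have ec i j : i != j -> quotient_rel e col (c i) (c j).
  by move=> ne; apply: Sclique; rewrite ?enum_valP ?(inj_eq c_inj).
(* The default [v0] is never reached: each of the at least two classes is an endpoint of a quotient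
   edge, hence nonempty. *)
pose rep i := odflt v0 [pick a | col a == c i].
have repP i : col (rep i) = c i.
  have [j ne] : exists j, i != j.
    by case: (eqVneq i ord0) => [->|ne]; [exists ord_max | exists ord0].
  have /existsP[a /existsP[b /and3P[_ ai _]]] := ec i j ne.
  by rewrite /rep; case: pickP => [a' /eqP //|/(_ a)]; rewrite ai.
by apply: (contra rep) => i j ne; rewrite !repP ec.
Qed.

(** * Arithmetic of the degree condition and the size bound *)

Local Open Scope ring_scope.

(** With [t = k + 2], [2t - 3] is [2k + 1], and the non-degree [n - d] is at most
    [(2 / (2k + 1) - eps) * n]. Multiplying by [s * (2k + 1)] and using [s * eps >= 1] gives the
    integer form. *)
Lemma degree_hyp_nat (R : realType) (k s n d : nat) (eps : R) :
  (d <= n)%N -> eps^-1 <= s%:R -> 0 < eps ->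
  ((2 * k.+2%:R - 5) / (2 * k.+2%:R - 3) + eps) * n%:R <= d%:R ->
  (s * (2 * k + 1) * (n - d) + (2 * k + 1) * n <= 2 * n * s)%N.
Proof.
move=> dn es e0; rewrite -[k.+2]addn2 natrD.
set D := _ - 3; have D0 : 0 < D by rewrite /D; have := ler0n R k; lra.
have -> : 2 * (k%:R + 2%:R) - 5 = D - 2 :> R by rewrite /D; ring.
have -> : (D - 2) / D + eps = (D - 2 + eps * D) / D by field; rewrite gt_eqF.
rewrite mulrAC ler_pdivrMr // => deg_ge.
have es1 : 1 <= s%:R * eps by rewrite -ler_pdivrMr // mul1r.
have s0 : 0 <= s%:R :> R by rewrite ler0n.
rewrite -(ler_nat R) natrD !natrM natrB // natrD natrM.
have -> : 2%:R * k%:R + 1%:R = D by rewrite /D; ring.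
have h1 := ler_wpM2l s0 deg_ge.
have h2 : D * n%:R <= s%:R * eps * (D * n%:R).
  by rewrite ler_peMl // mulr_ge0 ?ler0n // ltW.
rewrite -subr_ge0.
have -> : 2%:R * n%:R * s%:R - (s%:R * D * (n%:R - d%:R) + D * n%:R) =
  (s%:R * (d%:R * D) - s%:R * ((D - 2 + eps * D) * n%:R)) +
  (s%:R * eps * (D * n%:R) - D * n%:R) by ring.
by rewrite addr_ge0 // subr_ge0.
Qed.

Theorem theorem6p6 (R : realType) (t : nat) (ht : (3 <= t)%N) :
  exists p : {poly R},
    forall eps : R, 0 < eps ->
    forall (V : finType) (e : rel V),
      simple_graph e -> Kt_free e t ->
      (forall v : V,
          ((2 * t%:R - 5) / (2 * t%:R - 3) + eps) * #|V|%:R <= (deg e v)%:R) ->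
      exists (W : finType) (eW : rel W),
        [/\ simple_graph eW, Kt_free eW t,
            #|W|%:R <= 2 `^ p.[eps^-1] &
            exists f : V -> W, graph_hom e eW f].
Proof.
case: t ht => [|[|k]] // k0.
pose C := (64 * k * (k.+2 ^ 2 * 2 ^ k) ^ 3)%N.
(* Below, [q = C * s ^ (3 * k)] with [s <= eps^-1 + 1], and the quotient has at most
   [2 ^ (3 * q ^ 4)] vertices. *)
exists ((3 * C ^ 4)%:R *: ('X + 1) ^+ (12 * k)) => eps e0 V e eS Kfree degV.
have [V0|V0] := posnP #|V|.
  by exists V, e; split=> //; [rewrite V0 powR_ge0 | exists id].
pose s := (Num.truncn eps^-1).+1.
have es : eps^-1 <= s%:R by apply: ltW; apply: truncnS_gt.
have [//|m [col [mq qS qfree]]] := @homomorphic_quotient R V e k s k0 (ltn0Sn _) V0 eS Kfree.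
  move=> v; apply: degree_hyp_nat es e0 (degV v); exact: max_card.
exists {ffun 'I_m -> 'I_(2 * (64 * k * (k.+2 ^ 2 * (2 * s) ^ k) ^ 3) ^ 2).+1}%N.
exists (quotient_rel e col); split=> //; last first.
  exists col => a b eab; apply/existsP; exists a; apply/existsP; exists b.
  by rewrite eab !eqxx.
set q := (64 * k * _)%N in mq *.
have qE : q = (C * s ^ (3 * k))%N.
  by rewrite /q /C (expnMn 2) mulnA expnMn -expnM (mulnC k) mulnA.
have cardW : (#|{ffun 'I_m -> 'I_(2 * q ^ 2).+1}| <= 2 ^ (3 * q ^ 4))%N.
  rewrite card_ffun !card_ord.
  apply: (@leq_trans ((2 ^ (3 * q ^ 2)) ^ m)); last first.
    by rewrite -expnM leq_pexp2l //; have := leq_mul (leqnn (3 * q ^ 2)%N) mq; lia.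
  (* A positive [m] forces [q] positive, whence [2 * q ^ 2 + 1 <= 3 * q ^ 2 < 2 ^ (3 * q ^ 2)]. *)
  have [->|m0] := posnP m; first by rewrite !expn0.
  have q20 : (0 < q ^ 2)%N by apply: leq_trans m0 mq.
  by rewrite leq_exp2r // (leq_trans _ (ltn_expl _ _)) //; lia.
apply: (@le_trans _ _ (2 `^ (3 * q ^ 4)%:R)).
  by rewrite powR_mulrn // -natrX ler_nat.
apply: ler_powR; first by rewrite ler1n.
rewrite hornerZ horner_exp hornerD hornerX (hornerC 1).
have -> : (3 * q ^ 4)%:R = (3 * C ^ 4)%:R * s%:R ^+ (12 * k) :> R.
  by rewrite -natrX -natrM qE expnMn -expnM; congr (_ %:R); rewrite mulnA; congr (_ * _ ^ _)%N; lia.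
rewrite ler_wpM2l // lerXn2r ?nnegrE //.
  by rewrite addr_ge0 // invr_ge0 ltW.
rewrite -natr1 lerD2r truncn_le invr_ge0; exact: ltW.
Qed.
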